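(* Consider the flat Friedmann-Robertson-Walker cosmology of the Einstein-massless-scalar system with a barotropic fluid of index $\gamma$, $0\le\gamma\le 2$. Its asymptotic dynamics is described by the autonomous equation $$\Omega_m'=3(2-\gamma)\,\Omega_m(1-\Omega_m).$$ The critical points of this equation are: (i) $\Omega_m=0$, the scalar-field kinetic-energy dominated (stiff-matter) solution, for which $x^2=1$ and $3H^2=\dot\varphi^2/2$; (ii) $\Omega_m=1$, the matter-dominated solution, for which $3H^2=\rho_m$. The linear approximation around $\Omega_m=0$ is $\delta'=3(2-\gamma)\delta$, so that $\delta(\tau)=\delta_0\exp[3(2-\gamma)\tau]$. Hence the stiff-matter solution is unstable and is the past attractor in the phase line. In terms of the variable $x$ there are two stiff-matter past attractors: $x=1$ (growing $\varphi$) and $x=-1$ (decreasing $\varphi$). The linear approximation around $\Omega_m=1$ is $\delta'=-3(2-\gamma)\delta$, so that $\delta(\tau)=\delta_0\exp[-3(2-\gamma)\tau]$. Hence the matter-dominated solution is stable and is the future attractor in the phase line. In summary, the stiff-matter solution is the initial stage of the cosmic history and the matter-dominated universe is the final state, so that no accelerated expansion stage can be obtained.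
   Context: The cosmological equations of the Einstein-massless-scalar system are $3H^2=\rho_m+\tfrac12\dot\varphi^2$, $2\dot H=-\gamma\rho_m-\dot\varphi^2$, $\ddot\varphi+3H\dot\varphi=0$, $\dot\rho_m+3H(\rho_m+p_m)=0$. Dots are derivatives with respect to cosmic time $t$, $H\ge 0$ is the Hubble parameter (only expanding universes are considered), $\varphi$ is the massless scalar field, and $\rho_m$ is the energy density of a fluid with pressure $p_m=(\gamma-1)\rho_m$ (the most common values being $\gamma=1$ for dust and $\gamma=4/3$ for radiation). The prime denotes the derivative with respect to $\tau=\int H\,dt$. $\Omega_m=\rho_m/(3H^2)$ is the normalized matter energy density and $x=\dot\varphi/(\sqrt6H)$, $-1\le x\le 1$; they are related by $\Omega_m=1-x^2$. $\delta$ is a small perturbation of $\Omega_m$ about the critical point and $\delta_0$ is an integration constant. The same equation for $\Omega_m$ is obtained for the Sáez-Ballester cosmological model, in which $\tfrac12\dot\varphi^2$ is replaced by $\tfrac{\omega}{2}\phi^n\dot\phi^2$ with $\omega,n$ constants.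
   Formalization: Uniqueness of critical points, stability and attractor claims are for γ<2 (at γ=2 all points are critical); ''no accelerated expansion'' is proved exactly for γ≥2/3 (false below, e.g. de Sitter at γ=0); initial/final stages are for histories with both matter and a moving scalar field. *)

(* Defs.v *)
(* Standard-library reals with Coquelicot. *)
From Stdlib Require Import Reals Lra.
From Coquelicot Require Import Coquelicot.
Open Scope R_scope.

(** * The cosmological equations *)

(* Cosmic times form an open interval, possibly unbounded: an expanding
   solution generally starts at a big bang at finite cosmic time. *)
Definition cosmic_times (ta tb : Rbar) (t : R) : Prop :=
  Rbar_lt ta t /\ Rbar_lt t tb.

Definition fluid_pressure (gamma rho : R) : R := (gamma - 1) * rho.

(* [Derive] is total, so each equation is paired with differentiability.
   [0 <= rho t] is the standing convention -1 <= x <= 1, through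
   Omega_m = 1 - x^2. *)
Record cosmology (gamma : R) (ta tb : Rbar) (H phi rho : R -> R) : Prop := {
  cosmic_times_nonempty : Rbar_lt ta tb;
  hubble_nonneg : forall t, cosmic_times ta tb t -> 0 <= H t;
  density_nonneg : forall t, cosmic_times ta tb t -> 0 <= rho t;
  friedmann : forall t, cosmic_times ta tb t ->
    3 * H t ^ 2 = rho t + / 2 * Derive phi t ^ 2;
  raychaudhuri : forall t, cosmic_times ta tb t ->
    ex_derive H t /\
    2 * Derive H t = - gamma * rho t - Derive phi t ^ 2;
  klein_gordon : forall t, cosmic_times ta tb t ->
    ex_derive phi t /\ ex_derive (Derive phi) t /\
    Derive (Derive phi) t + 3 * H t * Derive phi t = 0;
  continuity_equation : forall t, cosmic_times ta tb t ->
    ex_derive rho t /\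
    Derive rho t + 3 * H t * (rho t + fluid_pressure gamma (rho t)) = 0
}.

Definition expanding (ta tb : Rbar) (H : R -> R) : Prop :=
  forall t, cosmic_times ta tb t -> 0 < H t.

(* A solution describing a whole cosmic history: it is not the restriction of
   a solution on a longer interval of cosmic time. *)
Definition inextendible (gamma : R) (ta tb : Rbar) (H phi rho : R -> R) : Prop :=
  forall (ta' tb' : Rbar) (H' phi' rho' : R -> R),
    cosmology gamma ta' tb' H' phi' rho' ->
    (forall t, cosmic_times ta tb t ->
       cosmic_times ta' tb' t /\ H' t = H t /\ phi' t = phi t /\ rho' t = rho t) ->
    forall t, cosmic_times ta' tb' t -> cosmic_times ta tb t.

Definition Omega_m (H rho : R -> R) (t : R) : R := rho t / (3 * H t ^ 2).

Definition x_var (H phi : R -> R) (t : R) : R :=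
  Derive phi t / (sqrt 6 * H t).

(* tau = int H dt, determined up to an additive constant. *)
Definition efold_time (ta tb : Rbar) (H tau : R -> R) : Prop :=
  forall t, cosmic_times ta tb t -> is_derive tau t (H t).

Definition scale_factor (ta tb : Rbar) (H a : R -> R) : Prop :=
  forall t, cosmic_times ta tb t -> 0 < a t /\ is_derive a t (H t * a t).

Definition accelerated_expansion (a : R -> R) (t : R) : Prop :=
  0 < Derive a t /\ 0 < Derive_n a 2 t.

(* Behaviour as t tends to the endpoint e from inside the interval. *)
Definition tends_at_end (ta tb e : Rbar) (u : R -> R) (l : R) : Prop :=
  filterlim u (within (cosmic_times ta tb) (Rbar_locally e)) (locally l).

(** * Autonomous equations u' = F(u) on a phase line S *)

Definition solves (F : R -> R) (I : R -> Prop) (u : R -> R) : Prop :=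
  forall s, I s -> is_derive u s (F (u s)).

Definition range_of_times (ta tb : Rbar) (tau : R -> R) (s : R) : Prop :=
  exists t, cosmic_times ta tb t /\ tau t = s.

Definition all_times (s : R) : Prop := True.

(* Complete orbits: the phase lines used below are compact and invariant, so
   every orbit in them is defined for all times. *)
Definition orbit (F : R -> R) (S : R -> Prop) (u : R -> R) : Prop :=
  solves F all_times u /\ forall s, S (u s).

Definition critical_point (F : R -> R) (p : R) : Prop := F p = 0.

(* [filterdiff]: L is linear and F q = F p + L (q - p) + o(q - p). *)
Definition linear_approximation (F : R -> R) (p : R) (L : R -> R) : Prop :=
  critical_point F p /\ filterdiff F (locally p) L.

Definition stable (F : R -> R) (S : R -> Prop) (p : R) : Prop :=
  forall eps, 0 < eps -> exists eta, 0 < eta /\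
    forall u, orbit F S u -> Rabs (u 0 - p) < eta ->
      forall s, 0 <= s -> Rabs (u s - p) < eps.

Definition future_attractor (F : R -> R) (S : R -> Prop) (p : R) : Prop :=
  S p /\ stable F S p /\
  exists eta, 0 < eta /\
    forall u, orbit F S u -> Rabs (u 0 - p) < eta -> is_lim u p_infty p.

(* Orbits of -F are the orbits of F run backwards. *)
Definition past_attractor (F : R -> R) (S : R -> Prop) (p : R) : Prop :=
  future_attractor (fun w => - F w) S p.

Definition Omega_field (gamma w : R) : R := 3 * (2 - gamma) * w * (1 - w).
Definition Omega_line (w : R) : Prop := 0 <= w <= 1.

(* Induced on x by Omega_m = 1 - x^2. *)
Definition x_field (gamma x : R) : R := - (3 / 2) * (2 - gamma) * x * (1 - x ^ 2).
Definition x_line (x : R) : Prop := -1 <= x <= 1.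

(* Main.v *)
(* In terms of tau the conservation laws integrate to rho = A e^(-3 gamma tau)
   and dphi/dt = B e^(-3 tau), and H > 0 is then determined by the Friedmann
   equation, so that Omega_m and x are explicit functions of tau.  Both phase
   lines reduce to the logistic equation w' = k w (1 - w) with k = 3 (2 - gamma)
   > 0: for Omega_m itself, for 1 - Omega_m backwards in time, and for x^2
   backwards in time.  Its orbits are explicit, and the sign of x is constant.

   For a cosmic history one needs tau to run through all of R.  Cosmic time is
   the integral T of dtau / H(tau), a diffeomorphism from R onto an open
   interval; its inverse gives a solution that extends any solution with the
   same A and B, hence coincides with the inextendible one.

   Acceleration: (d^2a/dt^2) / a = dH/dt + H^2 = (1/3 - gamma/2) rho - (dphi/dt)^2 / 3,
   which is nonpositive for gamma >= 2/3; for gamma < 2/3 take phi constant. *)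
Require Import Defs.
From Stdlib Require Import Reals Lra Psatz Ranalysis5 ClassicalEpsilon.
From Coquelicot Require Import Coquelicot.
Open Scope R_scope.

(** * Calculus on open intervals *)

(** The [Rmin]/[Rmax] form is the one in which the mean value theorem and the integrability
    criterion present an intermediate point, with [a] and [b] in either order. *)
Lemma cosmic_times_between ta tb a b c :
  cosmic_times ta tb a -> cosmic_times ta tb b -> Rmin a b <= c <= Rmax a b ->
  cosmic_times ta tb c.
Proof.
intros [a1 a2] [b1 b2] [c1 c2]; split.
- apply Rbar_lt_le_trans with (Finite (Rmin a b)); [|exact c1].
  now unfold Rmin; destruct (Rle_dec a b).
- apply Rbar_le_lt_trans with (Finite (Rmax a b)); [exact c2|].
  now unfold Rmax; destruct (Rle_dec a b).
Qed.

Lemma cosmic_times_open ta tb t :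
  cosmic_times ta tb t -> locally t (cosmic_times ta tb).
Proof.
intros [h1 h2].
apply filter_and; [now apply open_Rbar_gt | now apply open_Rbar_lt].
Qed.

Lemma cosmic_times_all t : cosmic_times m_infty p_infty t.
Proof. now split. Qed.

Lemma cosmic_times_exists ta tb : Rbar_lt ta tb -> exists t, cosmic_times ta tb t.
Proof.
destruct ta as [a| |]; destruct tb as [b| |]; simpl; intros h; try easy.
- exists ((a + b) / 2); split; simpl; lra.
- exists (a + 1); split; simpl; [lra | easy].
- exists (b - 1); split; simpl; [easy | lra].
- exists 0; easy.
Qed.

Lemma is_derive_zero_constant ta tb (f : R -> R) a b :
  (forall t, cosmic_times ta tb t -> is_derive f t 0) ->
  cosmic_times ta tb a -> cosmic_times ta tb b -> f a = f b.
Proof.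
intros df ha hb.
destruct (MVT_gen f a b (fun _ => 0)) as (c & _ & e).
- intros x hx; apply df, (cosmic_times_between ta tb a b); auto; lra.
- intros x hx; apply continuity_pt_filterlim, (ex_derive_continuous f x).
  exists 0; apply df, (cosmic_times_between ta tb a b); auto.
- lra.
Qed.

Lemma antiderivative_exists ta tb (f : R -> R) :
  Rbar_lt ta tb ->
  (forall t, cosmic_times ta tb t -> continuous f t) ->
  exists F : R -> R, forall t, cosmic_times ta tb t -> is_derive F t (f t).
Proof.
intros hab cf.
destruct (cosmic_times_exists ta tb hab) as [t0 h0].
exists (fun t => RInt f t0 t); intros t ht.
apply (is_derive_RInt f _ t0); [|now apply cf].
generalize (cosmic_times_open ta tb t ht); apply filter_imp; intros u hu.
apply (RInt_correct f t0 u), (ex_RInt_continuous f t0 u); intros z hz.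
apply cf, (cosmic_times_between ta tb t0 u); auto.
Qed.

(* The eta-expanded form in which [auto_derive] leaves the derivative of an
   unknown function. *)
Lemma Derive_value (f : R -> R) (x l : R) :
  is_derive f x l -> Derive (fun y : R => f y) x = l.
Proof. exact (is_derive_unique f x l). Qed.

(* Integrating factor. *)
Lemma linear_ode_solution ta tb (C c f : R -> R) a b :
  (forall t, cosmic_times ta tb t -> is_derive C t (c t)) ->
  (forall t, cosmic_times ta tb t -> is_derive f t (c t * f t)) ->
  cosmic_times ta tb a -> cosmic_times ta tb b ->
  f b = f a * exp (C b - C a).
Proof.
intros dC df ha hb.
assert (e : f b * exp (- C b) = f a * exp (- C a)).
{ apply (is_derive_zero_constant ta tb (fun t => f t * exp (- C t))); auto.
  intros t ht; pose proof (df t ht) as d1; pose proof (dC t ht) as d2.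
  auto_derive; [repeat split; [exists (c t * f t) | exists (c t)]; auto|].
  rewrite (Derive_value f _ _ d1), (Derive_value C _ _ d2); ring. }
unfold Rminus; rewrite exp_plus.
replace (f a * (exp (C b) * exp (- C a))) with (exp (C b) * (f a * exp (- C a))) by ring.
rewrite <- e, exp_Ropp; field; apply Rgt_not_eq, exp_pos.
Qed.

Lemma increasing_of_derive_pos ta tb (f df : R -> R) a b :
  (forall t, cosmic_times ta tb t -> is_derive f t (df t)) ->
  (forall t, cosmic_times ta tb t -> 0 < df t) ->
  cosmic_times ta tb a -> cosmic_times ta tb b -> a < b -> f a < f b.
Proof.
intros d p [ha _] [_ hb] ab.
apply (incr_function f ta tb df); auto.
- intros; apply d; split; auto.
- intros; apply p; split; auto.
Qed.

(** The range of a strictly increasing continuous function on the line is the open interval between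
    its infimum and supremum, either of which may be infinite. The inverse function theorem then
    gives the derivative of [g]. *)
Lemma increasing_diffeomorphism (f df : R -> R) :
  (forall s, is_derive f s (df s)) -> (forall s, 0 < df s) ->
  exists (ta tb : Rbar) (g : R -> R),
    (forall t, cosmic_times ta tb t <-> exists s, f s = t) /\
    (forall s, g (f s) = s) /\
    (forall s, is_derive g (f s) (/ df s)).
Proof.
intros d p.
assert (inc : forall a b, a < b -> f a < f b).
{ intros a b; apply (increasing_of_derive_pos m_infty p_infty f df); auto using cosmic_times_all. }
assert (cf : continuity f).
{ intros s; apply continuity_pt_filterlim, (ex_derive_continuous f s); exists (df s); auto. }
set (rng := fun t => exists s, f s = t).
(* Outside the range of [f] the value of [g] is arbitrary. *)
set (g := fun t => epsilon (inhabits 0) (fun s => f s = t)).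
assert (gf : forall s, g (f s) = s).
{ intros s; unfold g.
  assert (e : f (epsilon (inhabits 0) (fun r => f r = f s)) = f s).
  { apply (epsilon_spec (inhabits 0) (fun r => f r = f s)); now exists s. }
  destruct (Rtotal_order (epsilon (inhabits 0) (fun r => f r = f s)) s) as [l|[l|l]]; auto;
    apply inc in l; lra. }
assert (fg : forall t, rng t -> f (g t) = t).
{ intros t [s <-]; now rewrite gf. }
exists (Glb_Rbar rng), (Lub_Rbar rng), g.
destruct (Glb_Rbar_correct rng) as [gl gg].
destruct (Lub_Rbar_correct rng) as [lu ll].
split; [intros t; split; [intros [h1 h2] | intros [s <-]; split] | split].
(* If no value of [f] were below [t], then [t] would be a lower bound, against [h1]; likewise above.
   The intermediate value theorem then reaches [t]. *)
- destruct (classic (exists a, f a < t)) as [[a ha]|na].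
  2:{ exfalso; apply (Rbar_lt_not_le _ _ h1), gg; intros y [s <-]; simpl.
      destruct (Rle_lt_dec t (f s)); auto; exfalso; eauto. }
  destruct (classic (exists b, t < f b)) as [[b hb]|nb].
  2:{ exfalso; apply (Rbar_lt_not_le _ _ h2), ll; intros y [s <-]; simpl.
      destruct (Rle_lt_dec (f s) t); auto; exfalso; eauto. }
  destruct (IVT_gen f a b t cf) as [s [_ e]]; [|now exists s].
  rewrite Rmin_left, Rmax_right; lra.
(* The bounds are not attained: [f (s - 1)] and [f (s + 1)] lie strictly on either side of [f s]. *)
- apply Rbar_le_lt_trans with (Finite (f (s - 1))); [apply gl; now exists (s - 1)|].
  simpl; apply inc; lra.
- apply Rbar_lt_le_trans with (Finite (f (s + 1))); [|apply lu; now exists (s + 1)].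
  simpl; apply inc; lra.
- exact gf.
- intros s.
  (* The inverse function results are applied on the closed interval from [s - 1] to [s + 1], whose
     image lies in the range. *)
  assert (mid : forall t, f (s - 1) <= t <= f (s + 1) -> rng t).
  { intros t ht; destruct (IVT_gen f (s - 1) (s + 1) t cf) as [r [_ e]]; [|now exists r].
    assert (l : f (s - 1) < f (s + 1)) by (apply inc; lra).
    rewrite Rmin_left, Rmax_right; lra. }
  assert (l1 : f (s - 1) < f s) by (apply inc; lra).
  assert (l2 : f s < f (s + 1)) by (apply inc; lra).
  assert (cg : continuity_pt g (f s)).
  { apply (continuity_pt_recip_interv f g (s - 1) (s + 1)); try lra; auto.
    - intros x h1 h2; apply fg, mid; split; [exact h1 | exact h2].
    - intros x h1 h2.
      destruct (mid x (conj h1 h2)) as [r <-]; rewrite gf; split.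
      + destruct (Rle_lt_dec (s - 1) r) as [|i]; auto; apply inc in i; lra.
      + destruct (Rle_lt_dec r (s + 1)) as [|i]; auto; apply inc in i; lra. }
  assert (dd : forall a, derivable_pt f a).
  { intros a; exists (df a); apply is_derive_Reals, d. }
  apply is_derive_Reals.
  assert (gi : g (f (s - 1)) <= g (f s) <= g (f (s + 1))) by (rewrite !gf; lra).
  assert (de : derive_pt f (g (f s)) (dd (g (f s))) = df s).
  { rewrite Derive_Reals, gf; apply is_derive_unique, d. }
  pose proof (derivable_pt_lim_recip_interv f g (f (s - 1)) (f (s + 1)) (f s)
    (fun a _ => dd a) cg) as k.
  specialize (k ltac:(lra) ltac:(lra) gi).
  cbv beta in k; rewrite de in k.
  replace (/ df s) with (1 / df s) by (field; apply Rgt_not_eq, p).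
  apply k.
  + intros x hx; apply fg, mid, hx.
  + apply Rgt_not_eq, p.
Qed.

(** * Limits at the ends of an open interval *)

(** Treats finite and infinite ends together: the times after [t1] form a neighbourhood of [tb] in
    both cases, and [tb] cannot be [m_infty] since it exceeds [t1]. *)
Lemma tends_at_final_end ta tb u l :
  (forall eps, 0 < eps -> exists t1, cosmic_times ta tb t1 /\
     forall t, cosmic_times ta tb t -> t1 < t -> Rabs (u t - l) < eps) ->
  tends_at_end ta tb tb u l.
Proof.
intros h; apply filterlim_locally; intros [eps he].
destruct (h eps he) as (t1 & [h1 h2] & k).
unfold within.
destruct tb as [b| |]; simpl in *; try easy.
- generalize (open_gt t1 b h2); apply filter_imp; intros t l1 ht.
  apply k; auto.
- exists t1; intros t l1 ht; apply k; auto.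
Qed.

Lemma tends_at_initial_end ta tb u l :
  (forall eps, 0 < eps -> exists t1, cosmic_times ta tb t1 /\
     forall t, cosmic_times ta tb t -> t < t1 -> Rabs (u t - l) < eps) ->
  tends_at_end ta tb ta u l.
Proof.
intros h; apply filterlim_locally; intros [eps he].
destruct (h eps he) as (t1 & [h1 h2] & k).
unfold within.
destruct ta as [a| |]; simpl in *; try easy.
- generalize (open_lt t1 a h1); apply filter_imp; intros t l1 ht.
  apply k; auto.
- exists t1; intros t l1 ht; apply k; auto.
Qed.

(** * Solutions as functions of tau *)

(** With scale factor exp(s) these are the dilution laws a^(-3 gamma) and a^(-3); [A] and [B] are
    the values at s = 0. [hubble_rate] is the nonnegative root of the Friedmann equation, the one
    for expansion. *)
Definition fluid_density (gamma A s : R) : R := A * exp (- (3 * gamma) * s).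
Definition scalar_velocity (B s : R) : R := B * exp (- 3 * s).
Definition hubble_rate (gamma A B s : R) : R :=
  sqrt ((fluid_density gamma A s + / 2 * scalar_velocity B s ^ 2) / 3).
Definition Omega_profile (gamma A B s : R) : R :=
  fluid_density gamma A s / (3 * hubble_rate gamma A B s ^ 2).
Definition x_profile (gamma A B s : R) : R :=
  scalar_velocity B s / (sqrt 6 * hubble_rate gamma A B s).

Lemma fluid_density_nonneg gamma A s : 0 <= A -> 0 <= fluid_density gamma A s.
Proof. intros hA; apply Rmult_le_pos; [exact hA | apply Rlt_le, exp_pos]. Qed.

(** Together with [0 <= A], the condition [0 < A + B ^ 2] says that [A] and [B] do not both vanish,
    which rules out H = 0. *)
Lemma energy_density_pos gamma A B s : 0 <= A -> 0 < A + B ^ 2 ->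
  0 < fluid_density gamma A s + / 2 * scalar_velocity B s ^ 2.
Proof.
intros hA hAB; unfold fluid_density, scalar_velocity.
pose proof (exp_pos (- (3 * gamma) * s)); pose proof (exp_pos (- 3 * s)).
destruct (Req_dec B 0) as [->|nB].
- assert (0 < A) by lra; nra.
- assert (0 <= A * exp (- (3 * gamma) * s)) by nra.
  assert (B * exp (- 3 * s) <> 0) by (apply Rmult_integral_contrapositive; split; lra).
  assert (0 < (B * exp (- 3 * s)) ^ 2) by (apply pow2_gt_0; auto).
  lra.
Qed.

Lemma hubble_rate_pos gamma A B s : 0 <= A -> 0 < A + B ^ 2 ->
  0 < hubble_rate gamma A B s.
Proof.
intros hA hAB; pose proof (energy_density_pos gamma A B s hA hAB).
apply sqrt_lt_R0; lra.
Qed.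

Lemma hubble_rate_friedmann gamma A B s : 0 <= A ->
  3 * hubble_rate gamma A B s ^ 2 =
  fluid_density gamma A s + / 2 * scalar_velocity B s ^ 2.
Proof.
intros hA; unfold hubble_rate.
pose proof (fluid_density_nonneg gamma A s hA).
pose proof (pow2_ge_0 (scalar_velocity B s)).
rewrite pow2_sqrt; lra.
Qed.

Lemma fluid_density_derive gamma A s :
  is_derive (fluid_density gamma A) s (- (3 * gamma) * fluid_density gamma A s).
Proof. unfold fluid_density; auto_derive; auto; ring. Qed.

Lemma scalar_velocity_derive B s :
  is_derive (scalar_velocity B) s (- 3 * scalar_velocity B s).
Proof. unfold scalar_velocity; auto_derive; auto; ring. Qed.

(** This is the Raychaudhuri equation divided by 2H, because d/dtau = (1/H) d/dt. *)
Lemma hubble_rate_derive gamma A B s : 0 <= A -> 0 < A + B ^ 2 ->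
  is_derive (hubble_rate gamma A B) s
    ((- gamma * fluid_density gamma A s - scalar_velocity B s ^ 2) /
     (2 * hubble_rate gamma A B s)).
Proof.
intros hA hAB; pose proof (energy_density_pos gamma A B s hA hAB).
pose proof (hubble_rate_pos gamma A B s hA hAB) as hp.
pose proof (fluid_density_derive gamma A s) as d1.
pose proof (scalar_velocity_derive B s) as d2.
(* The shape produced by the chain rule for the square root. *)
replace ((- gamma * fluid_density gamma A s - scalar_velocity B s ^ 2) /
     (2 * hubble_rate gamma A B s)) with
  ((- (3 * gamma) * fluid_density gamma A s +
     / 2 * (2 * (- 3 * scalar_velocity B s) * scalar_velocity B s)) / 3 /
     (2 * hubble_rate gamma A B s)) by (field; lra).
apply (is_derive_sqrt
  (fun u => (fluid_density gamma A u + / 2 * scalar_velocity B u ^ 2) / 3)); [|lra].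
auto_derive.
- repeat split; [eexists; apply d1 | eexists; apply d2].
- rewrite (Derive_value (fluid_density gamma A) _ _ d1), (Derive_value (scalar_velocity B) _ _ d2).
  field.
Qed.

(** Quotient rule; the Friedmann equation eliminates the scalar velocity ([e2]), which leaves an
    identity between rational functions of density and H. *)
Lemma Omega_profile_solves gamma A B : 0 <= A -> 0 < A + B ^ 2 ->
  solves (Omega_field gamma) all_times (Omega_profile gamma A B).
Proof.
intros hA hAB s _.
pose proof (hubble_rate_pos gamma A B s hA hAB) as hp.
pose proof (hubble_rate_friedmann gamma A B s hA) as fr.
pose proof (fluid_density_derive gamma A s) as d1.
pose proof (hubble_rate_derive gamma A B s hA hAB) as d3.
unfold Omega_profile, Omega_field.
assert (e2 : scalar_velocity B s ^ 2 =
  6 * hubble_rate gamma A B s ^ 2 - 2 * fluid_density gamma A s) by lra.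
rewrite e2 in d3.
auto_derive.
- repeat split; [eexists; apply d1 | eexists; apply d3 |].
  apply Rgt_not_eq; nra.
- rewrite (Derive_value (fluid_density gamma A) _ _ d1),
    (Derive_value (hubble_rate gamma A B) _ _ d3).
  field; lra.
Qed.

(** The Friedmann equation divided by 3H^2. *)
Lemma Omega_profile_x_profile gamma A B s : 0 <= A -> 0 < A + B ^ 2 ->
  Omega_profile gamma A B s = 1 - x_profile gamma A B s ^ 2.
Proof.
intros hA hAB.
pose proof (hubble_rate_pos gamma A B s hA hAB) as hp.
pose proof (hubble_rate_friedmann gamma A B s hA) as fr.
unfold Omega_profile, x_profile.
assert (s6 : sqrt 6 ^ 2 = 6) by (apply pow2_sqrt; lra).
assert (0 < sqrt 6) by (apply sqrt_lt_R0; lra).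
replace (fluid_density gamma A s) with
  (3 * hubble_rate gamma A B s ^ 2 - / 2 * scalar_velocity B s ^ 2) by lra.
replace ((scalar_velocity B s / (sqrt 6 * hubble_rate gamma A B s)) ^ 2) with
  (scalar_velocity B s ^ 2 / (sqrt 6 ^ 2 * hubble_rate gamma A B s ^ 2)) by (field; lra).
rewrite s6; field; lra.
Qed.

Lemma x_profile_solves gamma A B : 0 <= A -> 0 < A + B ^ 2 ->
  solves (x_field gamma) all_times (x_profile gamma A B).
Proof.
intros hA hAB s _.
pose proof (hubble_rate_pos gamma A B s hA hAB) as hp.
pose proof (hubble_rate_friedmann gamma A B s hA) as fr.
pose proof (scalar_velocity_derive B s) as d2.
pose proof (hubble_rate_derive gamma A B s hA hAB) as d3.
assert (s6 : 0 < sqrt 6) by (apply sqrt_lt_R0; lra).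
unfold x_field.
(* With this factor written as Omega, the same elimination through [e2] applies as for
   [Omega_profile]. *)
replace (1 - x_profile gamma A B s ^ 2) with (Omega_profile gamma A B s)
  by now apply Omega_profile_x_profile.
unfold x_profile, Omega_profile.
assert (e2 : scalar_velocity B s ^ 2 =
  6 * hubble_rate gamma A B s ^ 2 - 2 * fluid_density gamma A s) by lra.
rewrite e2 in d3.
auto_derive.
- repeat split; [eexists; apply d2 | eexists; apply d3 |].
  apply Rgt_not_eq; nra.
- rewrite (Derive_value (scalar_velocity B) _ _ d2),
    (Derive_value (hubble_rate gamma A B) _ _ d3).
  field; lra.
Qed.

Lemma Omega_profile_line gamma A B s : 0 <= A -> 0 < A + B ^ 2 ->
  Omega_line (Omega_profile gamma A B s).
Proof.
intros hA hAB; split.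
- apply Rmult_le_pos; [now apply fluid_density_nonneg|].
  pose proof (hubble_rate_pos gamma A B s hA hAB).
  apply Rlt_le, Rinv_0_lt_compat; nra.
- rewrite (Omega_profile_x_profile gamma A B s hA hAB).
  pose proof (pow2_ge_0 (x_profile gamma A B s)); lra.
Qed.

Lemma x_line_of_Omega_line x : Omega_line (1 - x ^ 2) -> x_line x.
Proof. unfold Omega_line, x_line; intros h; split; nra. Qed.

(** The normalisation makes 3H^2 = 1 at s = 0, so that [A] prescribes the initial value. *)
Lemma Omega_profile_0 gamma A B : 0 <= A -> A + / 2 * B ^ 2 = 1 ->
  Omega_profile gamma A B 0 = A.
Proof.
intros hA e; unfold Omega_profile; rewrite (hubble_rate_friedmann gamma A B 0 hA).
unfold fluid_density, scalar_velocity.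
rewrite !Rmult_0_r, exp_0, !Rmult_1_r, e; field.
Qed.

(** Both conservation laws are linear and homogeneous, with coefficients that are multiples of H =
    dtau/dt; their solutions are therefore exponentials of multiples of tau. Expansion selects the
    positive root for H. *)
Lemma cosmology_profile gamma ta tb H phi rho tau :
  cosmology gamma ta tb H phi rho -> expanding ta tb H -> efold_time ta tb H tau ->
  exists A B, 0 <= A /\ 0 < A + B ^ 2 /\
    forall t, cosmic_times ta tb t ->
      rho t = fluid_density gamma A (tau t) /\
      Derive phi t = scalar_velocity B (tau t) /\
      H t = hubble_rate gamma A B (tau t).
Proof.
intros C E T.
destruct (cosmic_times_exists ta tb (cosmic_times_nonempty _ _ _ _ _ _ C)) as [t1 h1].
assert (e : exists A B, forall t, cosmic_times ta tb t ->
  rho t = fluid_density gamma A (tau t) /\ Derive phi t = scalar_velocity B (tau t)).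
(* Chosen to make both formulas exact at [t1]. *)
{ exists (rho t1 * exp (3 * gamma * tau t1)), (Derive phi t1 * exp (3 * tau t1)).
  intros t ht; unfold fluid_density, scalar_velocity.
  rewrite !Rmult_assoc, <- !exp_plus; split.
  - rewrite (linear_ode_solution ta tb (fun t => - (3 * gamma) * tau t)
      (fun t => - (3 * gamma) * H t) rho t1 t); auto.
    + f_equal; f_equal; ring.
    + intros u hu; apply (is_derive_scal tau u), T, hu.
    + intros u hu; destruct (continuity_equation _ _ _ _ _ _ C u hu) as [d q].
      apply Derive_correct in d; unfold fluid_pressure in q.
      replace (- (3 * gamma) * H u * rho u) with (Derive rho u) by lra; exact d.
  - rewrite (linear_ode_solution ta tb (fun t => - 3 * tau t)
      (fun t => - 3 * H t) (Derive phi) t1 t); auto.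
    + f_equal; f_equal; ring.
    + intros u hu; apply (is_derive_scal tau u), T, hu.
    + intros u hu; destruct (klein_gordon _ _ _ _ _ _ C u hu) as (_ & d & q).
      apply Derive_correct in d.
      replace (- 3 * H u * Derive phi u) with (Derive (Derive phi) u) by lra; exact d. }
destruct e as (A & B & e); exists A, B.
destruct (e t1 h1) as [e1 e2].
pose proof (E t1 h1) as p1.
pose proof (friedmann _ _ _ _ _ _ C t1 h1) as fr.
assert (hA : 0 <= A).
{ pose proof (density_nonneg _ _ _ _ _ _ C t1 h1) as q; rewrite e1 in q.
  unfold fluid_density in q; pose proof (exp_pos (- (3 * gamma) * tau t1)); nra. }
split; [exact hA | split].
- rewrite e1, e2 in fr; unfold fluid_density, scalar_velocity in fr.
  destruct (Req_dec B 0) as [->|nB]; [|pose proof (pow2_gt_0 B nB); lra].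
  destruct (Req_dec A 0) as [->|nA]; [|lra].
  (* [A] = [B] = 0 would give H = 0 at [t1], against expansion. *)
  exfalso; nra.
- intros t ht; destruct (e t ht) as [-> ->]; split; [|split]; auto.
  destruct (e t ht) as [f1 f2].
  pose proof (friedmann _ _ _ _ _ _ C t ht) as g; rewrite f1, f2 in g.
  unfold hubble_rate; rewrite <- g.
  replace (3 * H t ^ 2 / 3) with (H t ^ 2) by field.
  symmetry; apply sqrt_pow2, Rlt_le, E, ht.
Qed.

Lemma efold_time_exists gamma ta tb H phi rho :
  cosmology gamma ta tb H phi rho -> exists tau, efold_time ta tb H tau.
Proof.
intros C; apply (antiderivative_exists ta tb H).
- apply (cosmic_times_nonempty _ _ _ _ _ _ C).
- intros t ht; apply (ex_derive_continuous H t), (raychaudhuri _ _ _ _ _ _ C t ht).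
Qed.

Lemma Omega_m_x_var gamma ta tb H phi rho t :
  cosmology gamma ta tb H phi rho -> expanding ta tb H -> cosmic_times ta tb t ->
  Omega_m H rho t = 1 - x_var H phi t ^ 2.
Proof.
intros C E ht.
destruct (efold_time_exists _ _ _ _ _ _ C) as [tau T].
destruct (cosmology_profile _ _ _ _ _ _ _ C E T) as (A & B & hA & hAB & e).
destruct (e t ht) as (e1 & e2 & e3).
unfold Omega_m, x_var; rewrite e1, e2, e3.
now apply Omega_profile_x_profile.
Qed.

(** * Phase lines *)

Lemma solves_linear_iff k delta :
  solves (fun d => k * d) all_times delta <->
  exists delta0, forall s, delta s = delta0 * exp (k * s).
Proof.
split.
- intros S; exists (delta 0); intros s.
  rewrite (linear_ode_solution m_infty p_infty (fun s => k * s) (fun _ => k) delta 0 s);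
    auto using cosmic_times_all.
  + f_equal; f_equal; ring.
  + intros t _; auto_derive; auto; ring.
  + intros t _; apply S; exact I.
- intros [d0 e] s _.
  apply (is_derive_ext (fun t => d0 * exp (k * t))); [auto|].
  rewrite e; auto_derive; auto; ring.
Qed.

Lemma linear_approximation_of_derive F p l :
  F p = 0 -> is_derive F p l -> linear_approximation F p (fun d => l * d).
Proof.
intros h d; split; [exact h|].
apply (filterdiff_ext_lin F (fun y => scal y l)); [exact d|].
intros y; apply Rmult_comm.
Qed.

(** The map w -> a - w sends orbits of [G] to orbits of [F] and preserves distances. It is applied
    with a = 1, where it exchanges the ends of the Omega line under time reversal, and with a = 0
    for the odd field of x. *)
Lemma future_attractor_reflect F G (S : R -> Prop) a p :
  (forall w, G (a - w) = - F w) -> (forall w, S w -> S (a - w)) ->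
  future_attractor F S p -> future_attractor G S (a - p).
Proof.
intros hG hS (sp & st & eta & he & li).
assert (ob : forall u, orbit G S u -> orbit F S (fun s => a - u s)).
{ intros u [su lu]; split; [|now intros s; apply hS].
  intros s _; pose proof (su s I) as d; auto_derive; [now eexists; apply d|].
  rewrite (Derive_value u _ _ d); replace (u s) with (a - (a - u s)) at 1 by ring.
  rewrite hG; ring. }
assert (ab : forall w, Rabs (w - (a - p)) = Rabs (a - w - p)).
{ intros w; rewrite <- Rabs_Ropp; f_equal; ring. }
split; [now apply hS | split].
- intros eps hp; destruct (st eps hp) as (e & e0 & k); exists e; split; auto.
  intros u ou hu s hs; rewrite ab; apply (k (fun s => a - u s)); auto.
  now rewrite <- ab.
- exists eta; split; auto; intros u ou hu.
  apply (is_lim_ext (fun s => a - (a - u s))); [intros; ring|].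
  apply is_lim_minus'; [apply is_lim_const|].
  apply (li (fun s => a - u s)); auto.
  now rewrite <- ab.
Qed.

(** * The logistic equation *)

(** The difference D of the two sides satisfies D' = k (1 - u) D and vanishes at 0. The form without
    division avoids any discussion of the denominator. *)
Lemma logistic_closed_form k u :
  solves (fun w => k * w * (1 - w)) all_times u ->
  forall s, u s * (1 - u 0 + u 0 * exp (k * s)) = u 0 * exp (k * s).
Proof.
intros S s.
destruct (antiderivative_exists m_infty p_infty (fun t => k * (1 - u t))) as [C dC].
- exact I.
- intros t _; apply (ex_derive_continuous (fun t => k * (1 - u t)) t).
  pose proof (S t I) as d; auto_derive; now eexists; apply d.
- enough (e : u s * (1 - u 0 + u 0 * exp (k * s)) - u 0 * exp (k * s) = 0) by lra.
  rewrite (linear_ode_solution m_infty p_infty C (fun t => k * (1 - u t))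
    (fun t => u t * (1 - u 0 + u 0 * exp (k * t)) - u 0 * exp (k * t)) 0 s);
    auto using cosmic_times_all.
  + rewrite Rmult_0_r, exp_0; ring.
  + intros t _; pose proof (S t I) as d; auto_derive; [now eexists; apply d|].
    rewrite (Derive_value u _ _ d); ring.
Qed.

(** With E = exp(k s) >= 1 the closed form reads (u(s) - u(0)) (1 + u(0) (E - 1)) = u(0) (1 - u(0))
    (E - 1), whose right side is nonnegative. Hence the distance to 1 never exceeds its initial
    value. *)
Lemma logistic_stable k u s : 0 < k ->
  orbit (fun w => k * w * (1 - w)) Omega_line u -> 0 <= s -> u 0 <= u s.
Proof.
intros hk [so li] hs.
pose proof (logistic_closed_form k u so s) as e.
destruct (li 0), (li s).
assert (1 <= exp (k * s)).
{ assert (0 <= k * s) by nra; pose proof (exp_ineq1_le (k * s)); lra. }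
assert (0 <= u 0 * (1 - u 0) * (exp (k * s) - 1)).
{ apply Rmult_le_pos; [apply Rmult_le_pos|]; lra. }
assert (0 <= u 0 * (exp (k * s) - 1)) by (apply Rmult_le_pos; lra).
assert ((u s - u 0) * (1 + u 0 * (exp (k * s) - 1)) =
        u 0 * (1 - u 0) * (exp (k * s) - 1)) by lra.
destruct (Rle_lt_dec (u 0) (u s)); auto; exfalso; nra.
Qed.

(** The closed form gives (1 - u(s)) u(0) exp(k s) = (1 - u(0)) u(s) <= 1, and the bound exp(k s) >=
    1 + k s suffices for convergence. *)
Lemma logistic_limit k u : 0 < k ->
  orbit (fun w => k * w * (1 - w)) Omega_line u -> u 0 <> 0 ->
  is_lim u p_infty 1.
Proof.
intros hk [so li] h0; apply is_lim_spec; intros [eps he]; simpl.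
destruct (li 0) as [a0 a1]; assert (p0 : 0 < u 0) by lra.
assert (pp : 0 < k * u 0 * eps) by (apply Rmult_lt_0_compat; nra).
(* Beyond this time u(0) k s > 1/eps, hence 1 - u(s) < eps. *)
exists (/ (k * u 0 * eps)); intros s hs.
pose proof (logistic_closed_form k u so s) as e; destruct (li s) as [b0 b1].
pose proof (exp_ineq1_le (k * s)) as ex.
assert (q : 1 < k * u 0 * eps * s).
{ apply (Rmult_lt_compat_l (k * u 0 * eps)) in hs; auto.
  rewrite Rinv_r in hs; lra. }
rewrite Rabs_left1 by lra.
destruct (Rlt_le_dec (- (u s - 1)) eps) as [|c]; auto; exfalso.
assert ((1 - u s) * (u 0 * exp (k * s)) <= 1) by nra.
assert (0 < s).
{ apply Rlt_trans with (2 := hs); now apply Rinv_0_lt_compat. }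
assert (u 0 * (k * s) <= u 0 * exp (k * s)) by nra.
assert (0 <= u 0 * (k * s)) by (apply Rmult_le_pos; nra).
nra.
Qed.

(** * Attractors on the phase line of Omega *)

Lemma Omega_orbit_exists gamma w : Omega_line w ->
  exists u, orbit (Omega_field gamma) Omega_line u /\ u 0 = w.
Proof.
intros [h0 h1].
assert (q : sqrt (2 * (1 - w)) ^ 2 = 2 * (1 - w)) by (apply pow2_sqrt; lra).
assert (p : 0 < w + sqrt (2 * (1 - w)) ^ 2) by lra.
(* With A = w this value of B gives A + B^2/2 = 1, as [Omega_profile_0] asks. *)
exists (Omega_profile gamma w (sqrt (2 * (1 - w)))); split; [split|].
- now apply Omega_profile_solves.
- intros s; now apply Omega_profile_line.
- apply Omega_profile_0; lra.
Qed.

Lemma is_lim_eq (u : R -> R) (x : Rbar) (a b : R) : is_lim u x a -> is_lim u x b -> a = b.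
Proof.
intros h1 h2; apply is_lim_unique in h1; apply is_lim_unique in h2.
rewrite h1 in h2; now injection h2.
Qed.

Lemma Omega_one_stable gamma : gamma < 2 -> stable (Omega_field gamma) Omega_line 1.
Proof.
intros hg eps he; exists eps; split; auto; intros u ou hu s hs.
pose proof (logistic_stable (3 * (2 - gamma)) u s ltac:(lra) ou hs).
destruct (proj2 ou s), (proj2 ou 0).
rewrite Rabs_left1 in * by lra; lra.
Qed.

Lemma Omega_limit gamma u : gamma < 2 ->
  orbit (Omega_field gamma) Omega_line u -> u 0 <> 0 -> is_lim u p_infty 1.
Proof. intros hg; apply (logistic_limit (3 * (2 - gamma))); lra. Qed.

(** Every neighbourhood of [p] in the line contains a positive point, whose orbit tends to 1;
    uniqueness of limits forces p = 1. *)
Lemma Omega_future_attractor_iff gamma p : gamma < 2 ->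
  future_attractor (Omega_field gamma) Omega_line p <-> p = 1.
Proof.
intros hg; split.
- intros (sp & _ & eta & he & li).
  (* Positive even for p = 0, at most 1, and within [eta] of [p]. *)
  set (w := Rmin 1 (p + eta / 2)).
  assert (hw : 0 < w <= 1 /\ Rabs (w - p) < eta).
  { destruct sp; unfold w, Rmin; destruct (Rle_dec 1 (p + eta / 2));
      split; try lra; apply Rabs_def1; lra. }
  destruct (Omega_orbit_exists gamma w) as (u & ou & u0); [split; lra|].
  apply (is_lim_eq u p_infty); [apply li | apply (Omega_limit gamma)]; auto; rewrite u0; lra.
- intros ->; split; [split; lra | split; [now apply Omega_one_stable|]].
  (* Radius 1 excludes exactly the critical initial value 0. *)
  exists 1; split; [lra|]; intros u ou hu; apply (Omega_limit gamma); auto.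
  intros e; rewrite e, Rabs_left in hu; lra.
Qed.

Lemma Omega_past_attractor_iff gamma p : gamma < 2 ->
  past_attractor (Omega_field gamma) Omega_line p <-> p = 0.
Proof.
intros hg; unfold past_attractor; split.
- intros h.
  apply (future_attractor_reflect _ (Omega_field gamma) Omega_line 1) in h.
  + apply Omega_future_attractor_iff in h; lra.
  + intros w; unfold Omega_field; ring.
  + intros w [h1 h2]; split; lra.
- intros ->; replace 0 with (1 - 1) by ring.
  apply (future_attractor_reflect (Omega_field gamma)).
  + intros w; unfold Omega_field; ring.
  + intros w [h1 h2]; split; lra.
  + now apply Omega_future_attractor_iff.
Qed.

(** The field is invariant under w -> 1 - w, so 1 - u(-s) is again an orbit and the limit at plus
    infinity applies to it. *)
Lemma Omega_past_limit gamma u : gamma < 2 ->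
  orbit (Omega_field gamma) Omega_line u -> u 0 <> 1 -> is_lim u m_infty 0.
Proof.
intros hg [so li] h1.
assert (l : is_lim (fun s => 1 - u (- s)) p_infty 1).
{ apply (Omega_limit gamma); auto; [split|].
  - intros s _; pose proof (so (- s) I) as d; auto_derive; [now eexists; apply d|].
    rewrite (Derive_value u _ _ d); unfold Omega_field; ring.
  - intros s; destruct (li (- s)); split; lra.
  - rewrite Ropp_0; lra. }
apply is_lim_spec; intros eps; apply is_lim_spec in l; destruct (l eps) as [M hM].
exists (- M); intros s hs; specialize (hM (- s) ltac:(lra)); simpl in *.
rewrite Ropp_involutive in hM; rewrite <- Rabs_Ropp.
now replace (- (u s - 0)) with (1 - u s - 1) by ring.
Qed.

(** Orbits starting at arbitrarily small positive values still tend to 1, so they leave the ball of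
    radius 1/2 around 0. *)
Lemma Omega_zero_not_stable gamma : gamma < 2 -> ~ stable (Omega_field gamma) Omega_line 0.
Proof.
intros hg st; destruct (st (/ 2) ltac:(lra)) as (eta & he & k).
set (w := Rmin 1 (eta / 2)).
assert (hw : 0 < w <= 1 /\ w < eta).
{ unfold w, Rmin; destruct (Rle_dec 1 (eta / 2)); lra. }
destruct (Omega_orbit_exists gamma w) as (u & ou & u0); [split; lra|].
pose proof (Omega_limit gamma u hg ou ltac:(rewrite u0; lra)) as l.
apply is_lim_spec in l; destruct (l (mkposreal (/ 2) ltac:(lra))) as [M hM].
specialize (k u ou ltac:(rewrite u0, Rabs_right; lra)).
specialize (hM (Rmax 0 M + 1)); specialize (k (Rmax 0 M + 1)).
pose proof (Rmax_l 0 M); pose proof (Rmax_r 0 M).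
specialize (hM ltac:(lra)); specialize (k ltac:(lra)); simpl in hM.
apply Rabs_def2 in hM; apply Rabs_def2 in k; lra.
Qed.

(** * Attractors on the phase line of x *)

(** Backwards in time x^2 = 1 - Omega obeys the same logistic equation, so the results on the Omega
    line apply to x^2. *)
Lemma Omega_orbit_of_past_x_orbit gamma u :
  orbit (fun x => - x_field gamma x) x_line u ->
  orbit (Omega_field gamma) Omega_line (fun s => u s ^ 2).
Proof.
intros [so li]; split.
- intros s _; pose proof (so s I) as d; auto_derive; [now eexists; apply d|].
  rewrite (Derive_value u _ _ d); unfold Omega_field, x_field; field.
- intros s; destruct (li s); split; nra.
Qed.

(** The equation has the form u' = c(s) u, so u(s) is u(0) times an exponential. *)
Lemma x_orbit_sign gamma u s :
  orbit (fun x => - x_field gamma x) x_line u -> 0 < u 0 -> 0 < u s.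
Proof.
intros [so _] h0.
set (c := fun t => 3 / 2 * (2 - gamma) * (1 - u t ^ 2)).
destruct (antiderivative_exists m_infty p_infty c) as [C dC].
- exact I.
- intros t _; apply (ex_derive_continuous c t).
  pose proof (so t I) as d; unfold c; auto_derive; now eexists; apply d.
- rewrite (linear_ode_solution m_infty p_infty C c u 0 s); auto using cosmic_times_all.
  + apply Rmult_lt_0_compat; auto; apply exp_pos.
  + intros t _; pose proof (so t I) as d.
    replace (c t * u t) with (- x_field gamma (u t)) by (unfold c, x_field; field).
    exact d.
Qed.

(** Carries convergence of x^2 to 1 over to x, once x is known to be nonnegative. *)
Lemma Rabs_sub_one_le_sqr x : 0 <= x -> Rabs (x - 1) <= Rabs (x ^ 2 - 1).
Proof.
intros h; replace (x ^ 2 - 1) with ((x - 1) * (x + 1)) by ring.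
rewrite Rabs_mult, (Rabs_right (x + 1)) by lra.
pose proof (Rabs_pos (x - 1)); nra.
Qed.

Lemma x_past_attractor_one gamma : gamma < 2 -> past_attractor (x_field gamma) x_line 1.
Proof.
intros hg; split; [split; lra | split].
(* The bound 1 makes u(0) positive; eps/2 works because 1 - u(0)^2 <= 2 (1 - u(0)). *)
- intros eps he; exists (Rmin 1 (eps / 2)).
  assert (m := conj (Rmin_l 1 (eps / 2)) (Rmin_r 1 (eps / 2))).
  split; [apply Rmin_pos; lra|]; intros u ou hu s hs.
  assert (h0 : 0 < u 0) by (apply Rabs_def2 in hu; lra).
  pose proof (x_orbit_sign gamma u s ou h0).
  apply Rle_lt_trans with (1 := Rabs_sub_one_le_sqr (u s) ltac:(lra)).
  pose proof (Omega_orbit_of_past_x_orbit gamma u ou) as ow.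
  pose proof (logistic_stable (3 * (2 - gamma)) _ s ltac:(lra) ow hs) as l.
  destruct (proj2 ow s) as [b1 b2], (proj2 ou 0); simpl in l, b1, b2.
  apply Rabs_def2 in hu; apply Rabs_def1; simpl; nra.
- exists 1; split; [lra|]; intros u ou hu.
  assert (h0 : 0 < u 0) by (apply Rabs_def2 in hu; lra).
  pose proof (Omega_orbit_of_past_x_orbit gamma u ou) as ow.
  assert (l := Omega_limit gamma _ hg ow ltac:(cbv beta; nra)).
  apply is_lim_spec; intros eps; apply is_lim_spec in l; destruct (l eps) as [M hM].
  exists M; intros s hs; specialize (hM s hs).
  apply Rle_lt_trans with (2 := hM), Rabs_sub_one_le_sqr, Rlt_le.
  now apply (x_orbit_sign gamma).
Qed.

Lemma past_x_orbit_exists gamma x : x_line x -> 0 < x ->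
  exists u, orbit (fun x => - x_field gamma x) x_line u /\ u 0 = x.
Proof.
intros [h1 h2] h0.
assert (hA : 0 <= 1 - x ^ 2) by nra.
assert (s2 : sqrt 2 ^ 2 = 2) by (apply pow2_sqrt; lra).
(* Again A + B^2/2 = 1, so Omega starts at 1 - x^2; the positive sign of B then singles out the root
   x rather than -x. *)
set (A := 1 - x ^ 2) in *; set (B := sqrt 2 * x).
assert (hB : B ^ 2 = 2 * x ^ 2).
{ unfold B; rewrite Rpow_mult_distr, s2; ring. }
assert (hAB : 0 < A + B ^ 2) by (rewrite hB; unfold A; nra).
assert (bp : 0 < B) by (apply Rmult_lt_0_compat; auto; apply sqrt_lt_R0; lra).
exists (fun s => x_profile gamma A B (- s)); split; [split|].
- intros s _; pose proof (x_profile_solves gamma A B hA hAB (- s) I) as d.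
  auto_derive; [now eexists; apply d|].
  rewrite (Derive_value (x_profile gamma A B) _ _ d); ring.
- intros s; apply x_line_of_Omega_line.
  rewrite <- (Omega_profile_x_profile gamma A B (- s)); auto; now apply Omega_profile_line.
- rewrite Ropp_0.
  pose proof (Omega_profile_x_profile gamma A B 0 hA hAB) as e.
  rewrite Omega_profile_0 in e; auto; [|rewrite hB; unfold A; field].
  assert (0 < x_profile gamma A B 0).
  { apply Rmult_lt_0_compat.
    - unfold scalar_velocity; rewrite Rmult_0_r, exp_0; lra.
    - apply Rinv_0_lt_compat, Rmult_lt_0_compat.
      + apply sqrt_lt_R0; lra.
      + now apply hubble_rate_pos. }
  unfold A in e at 1; nra.
Qed.

(** The field is odd, which reduces the claim to p >= 0. There a positive orbit starting near p, run
    backwards, has x^2 tending both to 1 and to p^2. *)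
Lemma x_past_attractor_iff gamma p : gamma < 2 ->
  past_attractor (x_field gamma) x_line p <-> p = 1 \/ p = -1.
Proof.
intros hg.
assert (refl : forall q, past_attractor (x_field gamma) x_line q ->
  past_attractor (x_field gamma) x_line (0 - q)).
{ intros q; apply future_attractor_reflect.
  - intros w; unfold x_field; field.
  - intros w [h1 h2]; split; lra. }
assert (nonneg : forall q, 0 <= q -> past_attractor (x_field gamma) x_line q -> q = 1).
{ intros q hq (sq & _ & eta & he & li).
  set (x := Rmin 1 (q + eta / 2)).
  assert (hx : 0 < x <= 1 /\ Rabs (x - q) < eta).
  { destruct sq; unfold x, Rmin; destruct (Rle_dec 1 (q + eta / 2));
      split; try lra; apply Rabs_def1; lra. }
  destruct (past_x_orbit_exists gamma x) as (u & ou & u0); [split; lra | lra |].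
  assert (l : is_lim u p_infty q) by (apply li; auto; rewrite u0; lra).
  assert (l2 : is_lim (fun s => u s ^ 2) p_infty 1).
  { apply (Omega_limit gamma); auto; [now apply Omega_orbit_of_past_x_orbit|].
    rewrite u0; nra. }
  assert (l3 : is_lim (fun s => u s ^ 2) p_infty (q ^ 2)).
  { apply (is_lim_ext (fun s => u s * u s)); [intros; ring|].
    replace (q ^ 2) with (q * q) by ring.
    apply (is_lim_mult u u p_infty q q); auto; exact I. }
  pose proof (is_lim_eq _ _ _ _ l2 l3); nra. }
split.
- intros h; destruct (Rle_lt_dec 0 p).
  + left; auto.
  + right; apply refl, nonneg in h; lra.
- intros [-> | ->]; [now apply x_past_attractor_one|].
  replace (-1) with (0 - 1) by ring; now apply refl, x_past_attractor_one.
Qed.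

(** * Inextendible solutions *)

(** [T] is cosmic time as a function of tau, and the solution is the profile composed with the
    inverse of [T]. The normalisation at [s0] allows it to be matched with a given solution at one
    time. *)
Lemma maximal_cosmology gamma A B s0 t0 phi0 : 0 <= A -> 0 < A + B ^ 2 ->
  exists (ta tb : Rbar) (H phi rho T : R -> R),
    cosmology gamma ta tb H phi rho /\
    (forall s, cosmic_times ta tb (T s)) /\
    (forall s s', T s = T s' -> s = s') /\
    T s0 = t0 /\ phi t0 = phi0 /\
    (forall s, is_derive T s (/ hubble_rate gamma A B s)) /\
    (forall s, H (T s) = hubble_rate gamma A B s /\
               rho (T s) = fluid_density gamma A s /\
               Derive phi (T s) = scalar_velocity B s).
Proof.
intros hA hAB.
set (h := hubble_rate gamma A B); set (psi := scalar_velocity B).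
set (fd := fluid_density gamma A).
assert (hp : forall s, 0 < h s) by (intros; now apply hubble_rate_pos).
assert (dh : forall s, is_derive h s ((- gamma * fd s - psi s ^ 2) / (2 * h s)))
  by (intros; now apply hubble_rate_derive).
assert (dpsi : forall s, is_derive psi s (- 3 * psi s)) by (intros; apply scalar_velocity_derive).
assert (dfd : forall s, is_derive fd s (- (3 * gamma) * fd s))
  by (intros; apply fluid_density_derive).
destruct (antiderivative_exists m_infty p_infty (fun s => / h s)) as [T0 dT0].
{ exact I. }
{ intros s _; apply (ex_derive_continuous (fun s => / h s) s).
  auto_derive; split; [eexists; apply dh|]; split; auto; apply Rgt_not_eq, hp. }
(* [P] is the scalar field as a function of tau: dphi/dtau = (dphi/dt)/H. *)
destruct (antiderivative_exists m_infty p_infty (fun s => psi s / h s)) as [P dP].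
{ exact I. }
{ intros s _; apply (ex_derive_continuous (fun s => psi s / h s) s).
  auto_derive; repeat split; [eexists; apply dpsi | eexists; apply dh | apply Rgt_not_eq, hp]. }
set (T := fun s => T0 s + (t0 - T0 s0)).
assert (dT : forall s, is_derive T s (/ h s)).
{ intros s; pose proof (dT0 s (cosmic_times_all s)) as d; unfold T.
  auto_derive; [now eexists; apply d|]; rewrite (Derive_value T0 _ _ d); ring. }
destruct (increasing_diffeomorphism T (fun s => / h s) dT) as (ta & tb & g & rng & gT & dg).
{ intros s; apply Rinv_0_lt_compat, hp. }
assert (dg' : forall s, is_derive g (T s) (h s)).
{ intros s; rewrite <- (Rinv_inv (h s)); apply dg. }
set (phi := fun t => P (g t) + (phi0 - P s0)).
assert (dphi : forall s, is_derive phi (T s) (psi s)).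
{ intros s; pose proof (dP s (cosmic_times_all s)) as d; pose proof (dg' s) as d'; unfold phi.
  rewrite <- (gT s) in d at 1; auto_derive; [split; [now eexists; apply d | split; [now eexists; apply d' | exact I]]|].
  rewrite (Derive_value P _ _ d), (Derive_value g _ _ d'); field; apply Rgt_not_eq, hp. }
assert (vphi : forall s, Derive phi (T s) = psi s).
{ intros s; apply is_derive_unique, dphi. }
assert (T0s : T s0 = t0) by (unfold T; ring).
assert (comp : forall f df s, is_derive f s df -> is_derive (fun t => f (g t)) (T s) (h s * df)).
{ intros f df s d; apply (is_derive_comp f g); [now rewrite gT | apply dg']. }
assert (tT : forall s, cosmic_times ta tb (T s)) by (intros s; apply rng; now exists s).
exists ta, tb, (fun t => h (g t)), phi, (fun t => fd (g t)), T.
repeat apply conj.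
- split.
  + destruct (tT s0) as [h1 h2]; now apply Rbar_lt_trans with (T s0).
  + intros t _; apply Rlt_le, hp.
  + intros t _; now apply fluid_density_nonneg.
  + intros t ht; apply rng in ht; destruct ht as [s <-].
    rewrite gT, vphi; now apply hubble_rate_friedmann.
  + intros t ht; apply rng in ht; destruct ht as [s <-].
    pose proof (comp _ _ _ (dh s)) as d; split; [now eexists; apply d|].
    rewrite (Derive_value _ _ _ d), gT, vphi; field; apply Rgt_not_eq, hp.
  + intros t ht; apply rng in ht; destruct ht as [s <-].
    assert (d : is_derive (Derive phi) (T s) (h s * (- 3 * psi s))).
    (* The velocity is known to agree with psi(g(t)) only on the interval, whence the local form. *)
    { apply (is_derive_ext_loc (fun t => psi (g t))); [|apply comp, dpsi].
      generalize (cosmic_times_open ta tb (T s) (tT s)); apply filter_imp.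
      intros t ht; apply rng in ht; destruct ht as [r <-]; now rewrite gT, vphi. }
    split; [eexists; apply dphi | split; [eexists; apply d|]].
    rewrite (is_derive_unique _ _ _ d), gT, vphi; ring.
  + intros t ht; apply rng in ht; destruct ht as [s <-].
    pose proof (comp _ _ _ (dfd s)) as d; split; [now eexists; apply d|].
    rewrite (Derive_value _ _ _ d), gT; unfold fluid_pressure; ring.
- exact tT.
- intros s s' e; now rewrite <- (gT s), e, gT.
- exact T0s.
- unfold phi; rewrite <- T0s, gT; ring.
- exact dT.
- intros s; rewrite gT; auto.
Qed.

(* The maximal solution with the same profile extends the given one, so an
   inextendible solution runs through all values of tau. *)
Lemma inextendible_efold_time_onto gamma ta tb H phi rho tau s :
  cosmology gamma ta tb H phi rho -> expanding ta tb H ->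
  inextendible gamma ta tb H phi rho -> efold_time ta tb H tau ->
  exists t, cosmic_times ta tb t /\ tau t = s.
Proof.
intros C E X Et.
destruct (cosmology_profile _ _ _ _ _ _ _ C E Et) as (A & B & hA & hAB & e).
destruct (cosmic_times_exists ta tb (cosmic_times_nonempty _ _ _ _ _ _ C)) as [t0 h0].
destruct (maximal_cosmology gamma A B (tau t0) t0 (phi t0) hA hAB)
  as (ta' & tb' & H' & phi' & rho' & T & C' & tT & inj & Tt0 & p0 & dT & v).
assert (inv : forall t, cosmic_times ta tb t -> T (tau t) = t).
(* The derivative of T(tau(t)) - t is (1/H) H - 1 = 0, and the difference vanishes at [t0]. *)
{ intros t ht.
  enough (T (tau t) - t = T (tau t0) - t0) by lra.
  apply (is_derive_zero_constant ta tb (fun t => T (tau t) - t)); auto.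
  intros u hu; pose proof (dT (tau u)) as d; pose proof (Et u hu) as d'.
  auto_derive; [split; [now eexists; apply d | split; [now eexists; apply d' | exact I]]|].
  rewrite (Derive_value T _ _ d), (Derive_value tau _ _ d').
  destruct (e u hu) as (_ & _ & <-); field; apply Rgt_not_eq, E, hu. }
assert (ext : forall t, cosmic_times ta tb t ->
  cosmic_times ta' tb' t /\ H' t = H t /\ phi' t = phi t /\ rho' t = rho t).
{ assert (ct : forall t, cosmic_times ta tb t -> cosmic_times ta' tb' t).
  { intros t ht; rewrite <- (inv t ht); apply tT. }
  intros t ht; destruct (e t ht) as (e1 & e2 & e3).
  destruct (v (tau t)) as (v1 & v2 & v3); rewrite (inv t ht) in v1, v2, v3.
  split; [auto | split; [congruence | split; [|congruence]]].
  (* Both fields have the same velocity [scalar_velocity B (tau u)] and agree at [t0]. *)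
  enough (phi' t - phi t = phi' t0 - phi t0) by lra.
  apply (is_derive_zero_constant ta tb (fun t => phi' t - phi t)); auto.
  intros u hu.
  destruct (klein_gordon _ _ _ _ _ _ C u hu) as (d & _).
  destruct (klein_gordon _ _ _ _ _ _ C' u (ct u hu)) as (d' & _).
  destruct (e u hu) as (_ & q & _), (v (tau u)) as (_ & _ & q'); rewrite (inv u hu) in q'.
  auto_derive; [now repeat split|].
  change (1 * Derive phi' u + - (1 * Derive phi u) = 0); rewrite q, q'; ring. }
(* Inextendibility puts [T s] in the original interval, where T(tau(T s)) = T s; injectivity of [T]
   gives tau(T s) = s. *)
pose proof (X ta' tb' H' phi' rho' C' ext (T s) (tT s)) as hs.
exists (T s); split; [exact hs|]; apply inj, inv, hs.
Qed.

(** * Initial and final stages of a cosmic history *)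

Lemma efold_time_increasing ta tb H tau a b :
  expanding ta tb H -> efold_time ta tb H tau ->
  cosmic_times ta tb a -> cosmic_times ta tb b -> a < b -> tau a < tau b.
Proof. intros E Et; now apply (increasing_of_derive_pos ta tb tau H). Qed.

(** Since tau is onto, some time has tau = M; since tau increases, all later times have tau > M. *)
Lemma tends_at_final_end_of_is_lim ta tb H tau u U l :
  expanding ta tb H -> efold_time ta tb H tau ->
  (forall s, exists t, cosmic_times ta tb t /\ tau t = s) ->
  (forall t, cosmic_times ta tb t -> u t = U (tau t)) ->
  is_lim U p_infty (Finite l) -> tends_at_end ta tb tb u l.
Proof.
intros E Et onto eq li; apply tends_at_final_end; intros eps he.
apply is_lim_spec in li; destruct (li (mkposreal eps he)) as [M hM].
destruct (onto M) as (t1 & h1 & e1); exists t1; split; auto; intros t ht lt.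
rewrite (eq t ht); apply hM; rewrite <- e1; now apply (efold_time_increasing ta tb H).
Qed.

Lemma tends_at_initial_end_of_is_lim ta tb H tau u U l :
  expanding ta tb H -> efold_time ta tb H tau ->
  (forall s, exists t, cosmic_times ta tb t /\ tau t = s) ->
  (forall t, cosmic_times ta tb t -> u t = U (tau t)) ->
  is_lim U m_infty (Finite l) -> tends_at_end ta tb ta u l.
Proof.
intros E Et onto eq li; apply tends_at_initial_end; intros eps he.
apply is_lim_spec in li; destruct (li (mkposreal eps he)) as [M hM].
destruct (onto M) as (t1 & h1 & e1); exists t1; split; auto; intros t ht lt.
rewrite (eq t ht); apply hM; rewrite <- e1; now apply (efold_time_increasing ta tb H).
Qed.

Lemma tends_at_end_opp ta tb e u l :
  tends_at_end ta tb e (fun t => - u t) l -> tends_at_end ta tb e u (- l).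
Proof.
intros h; apply (filterlim_ext (fun t => - - u t)); [intros; apply Ropp_involutive|].
apply (filterlim_comp _ _ _ (fun t => - u t) Ropp _ (locally l)); [exact h|].
apply (filterlim_opp l).
Qed.

Lemma x_tends_to_one ta tb e u w :
  (forall t, cosmic_times ta tb t -> 0 <= u t /\ w t = 1 - u t ^ 2) ->
  tends_at_end ta tb e w 0 -> tends_at_end ta tb e u 1.
Proof.
intros hu hw; apply filterlim_locally; intros eps.
pose proof (proj1 (filterlim_locally w 0) hw eps) as k; unfold within in *.
revert k; apply filter_imp; intros t k ht; specialize (k ht).
destruct (hu t ht) as [p q].
change (Rabs (w t - 0) < eps) in k; change (Rabs (u t - 1) < eps).
apply Rle_lt_trans with (1 := Rabs_sub_one_le_sqr (u t) p).
rewrite <- Rabs_Ropp; now replace (- (u t ^ 2 - 1)) with (w t - 0) by (rewrite q; ring).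
Qed.

(** The presence of both components at [t0] means A > 0 and B <> 0, so the orbit starts at neither
    critical point ([w0], [w1]). *)
Lemma Omega_history gamma ta tb H phi rho t0 :
  gamma < 2 ->
  cosmology gamma ta tb H phi rho -> expanding ta tb H ->
  inextendible gamma ta tb H phi rho ->
  cosmic_times ta tb t0 -> 0 < rho t0 -> Derive phi t0 <> 0 ->
  tends_at_end ta tb ta (Omega_m H rho) 0 /\ tends_at_end ta tb tb (Omega_m H rho) 1.
Proof.
intros hg C E X h0 r0 p0.
destruct (efold_time_exists _ _ _ _ _ _ C) as [tau Et].
destruct (cosmology_profile _ _ _ _ _ _ _ C E Et) as (A & B & hA & hAB & e).
set (W := fun s => Omega_profile gamma A B s).
assert (ow : orbit (Omega_field gamma) Omega_line W).
{ split; [now apply Omega_profile_solves | intros s; now apply Omega_profile_line]. }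
assert (eq : forall t, cosmic_times ta tb t -> Omega_m H rho t = W (tau t)).
{ intros t ht; destruct (e t ht) as (e1 & _ & e3); unfold Omega_m; now rewrite e1, e3. }
destruct (e t0 h0) as (e1 & e2 & _).
assert (pA : 0 < A).
{ rewrite e1 in r0; unfold fluid_density in r0.
  pose proof (exp_pos (- (3 * gamma) * tau t0)); nra. }
assert (nB : B <> 0).
{ intros b; apply p0; rewrite e2; unfold scalar_velocity; rewrite b; ring. }
pose proof (hubble_rate_pos gamma A B 0 hA hAB) as hp.
assert (w0 : W 0 <> 0).
{ apply Rgt_not_eq, Rmult_lt_0_compat.
  - unfold fluid_density; rewrite Rmult_0_r, exp_0; lra.
  - apply Rinv_0_lt_compat; nra. }
assert (w1 : W 0 <> 1).
{ unfold W; rewrite Omega_profile_x_profile; auto.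
  enough (0 < x_profile gamma A B 0 ^ 2) by lra.
  apply pow2_gt_0, Rmult_integral_contrapositive; split.
  - unfold scalar_velocity; rewrite Rmult_0_r, exp_0; lra.
  - apply Rinv_neq_0_compat, Rgt_not_eq, Rmult_lt_0_compat; auto; apply sqrt_lt_R0; lra. }
pose proof (fun s => inextendible_efold_time_onto _ _ _ _ _ _ tau s C E X Et) as onto.
split.
- apply (tends_at_initial_end_of_is_lim ta tb H tau _ W); auto; now apply (Omega_past_limit gamma).
- apply (tends_at_final_end_of_is_lim ta tb H tau _ W); auto; now apply (Omega_limit gamma).
Qed.

(** The velocity B exp(-3 tau) keeps the sign of B. The product form serves growing and decreasing
    fields alike. *)
Lemma scalar_velocity_sign gamma ta tb H phi rho t0 t :
  cosmology gamma ta tb H phi rho -> expanding ta tb H ->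
  cosmic_times ta tb t0 -> cosmic_times ta tb t ->
  0 < Derive phi t0 * Derive phi t \/ Derive phi t0 = 0.
Proof.
intros C E h0 ht.
destruct (efold_time_exists _ _ _ _ _ _ C) as [tau Et].
destruct (cosmology_profile _ _ _ _ _ _ _ C E Et) as (A & B & _ & _ & e).
destruct (e t0 h0) as (_ & -> & _), (e t ht) as (_ & -> & _); unfold scalar_velocity.
destruct (Req_dec B 0) as [->|nB]; [right; ring | left].
replace (B * exp (- 3 * tau t0) * (B * exp (- 3 * tau t))) with
  (B ^ 2 * (exp (- 3 * tau t0) * exp (- 3 * tau t))) by ring.
apply Rmult_lt_0_compat; [now apply pow2_gt_0|].
apply Rmult_lt_0_compat; apply exp_pos.
Qed.

(** Omega tends to 0, so x^2 tends to 1, and the constant sign of x decides the limit; for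
    decreasing phi the argument is applied to -x. *)
Lemma x_history gamma ta tb H phi rho t0 :
  gamma < 2 ->
  cosmology gamma ta tb H phi rho -> expanding ta tb H ->
  inextendible gamma ta tb H phi rho ->
  cosmic_times ta tb t0 -> 0 < rho t0 ->
  (0 < Derive phi t0 -> tends_at_end ta tb ta (x_var H phi) 1) /\
  (Derive phi t0 < 0 -> tends_at_end ta tb ta (x_var H phi) (-1)).
Proof.
intros hg C E X h0 r0.
assert (den : forall t, cosmic_times ta tb t -> 0 < / (sqrt 6 * H t)).
{ intros t ht; apply Rinv_0_lt_compat, Rmult_lt_0_compat; [apply sqrt_lt_R0; lra | now apply E]. }
split; intros p0.
- apply (x_tends_to_one ta tb ta _ (Omega_m H rho)).
  + intros t ht; split; [|now apply (Omega_m_x_var gamma ta tb)].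
    destruct (scalar_velocity_sign gamma ta tb H phi rho t0 t); auto; [|lra].
    apply Rmult_le_pos; [nra | now apply Rlt_le, den].
  + apply (Omega_history gamma ta tb H phi rho t0); auto; lra.
- apply tends_at_end_opp, (x_tends_to_one ta tb ta _ (Omega_m H rho)).
  + intros t ht; split.
    * destruct (scalar_velocity_sign gamma ta tb H phi rho t0 t); auto; [|lra].
      replace (- x_var H phi t) with (- Derive phi t * / (sqrt 6 * H t))
        by (unfold x_var, Rdiv; ring).
      apply Rmult_le_pos; [nra | now apply Rlt_le, den].
    * rewrite (Omega_m_x_var gamma ta tb H phi rho t); auto; ring.
  + apply (Omega_history gamma ta tb H phi rho t0); auto; lra.
Qed.

(** * Acceleration *)

Lemma scale_factor_acceleration ta tb H a t :
  (forall u, cosmic_times ta tb u -> ex_derive H u) ->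
  scale_factor ta tb H a -> cosmic_times ta tb t ->
  Derive_n a 2 t = (Derive H t + H t ^ 2) * a t.
Proof.
intros dH S ht; simpl.
rewrite (Derive_ext_loc (Derive a) (fun u => H u * a u)).
- destruct (S t ht) as [_ d]; rewrite Derive_mult; [|now apply dH | now eexists; apply d].
  rewrite (is_derive_unique _ _ _ d); ring.
- generalize (cosmic_times_open ta tb t ht); apply filter_imp; intros u hu.
  apply is_derive_unique, S, hu.
Qed.

Lemma no_acceleration gamma ta tb H phi rho a t : 2 / 3 <= gamma ->
  cosmology gamma ta tb H phi rho -> scale_factor ta tb H a ->
  cosmic_times ta tb t -> ~ accelerated_expansion a t.
Proof.
intros hg C S ht [_ acc].
rewrite (scale_factor_acceleration ta tb H a t) in acc; auto;
  [|now intros u hu; apply (raychaudhuri _ _ _ _ _ _ C u hu)].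
destruct (S t ht) as [pa _].
pose proof (density_nonneg _ _ _ _ _ _ C t ht).
pose proof (friedmann _ _ _ _ _ _ C t ht).
destruct (raychaudhuri _ _ _ _ _ _ C t ht) as [_ q].
pose proof (pow2_ge_0 (Derive phi t)).
(* After this bound the equations are linear in rho, H^2 and the squared velocity. *)
assert (2 / 3 * rho t <= gamma * rho t) by nra.
assert (Derive H t + H t ^ 2 <= 0) by lra.
nra.
Qed.

(* Without scalar field, dH/dt = - (3 gamma / 2) H^2; this choice of H also covers
   the de Sitter case gamma = 0. *)
Lemma fluid_cosmology gamma : 0 <= gamma ->
  let H := fun t => / (1 + 3 * gamma / 2 * t) in
  cosmology gamma 0 1 H (fun _ => 0) (fun t => 3 * H t ^ 2) /\
  forall t, cosmic_times 0 1 t -> is_derive H t (- (3 * gamma / 2) * H t ^ 2).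
Proof.
intros hg H.
assert (dp : forall t, cosmic_times 0 1 t -> 0 < 1 + 3 * gamma / 2 * t).
{ intros t [h1 h2]; simpl in *; nra. }
assert (dH : forall t, cosmic_times 0 1 t -> is_derive H t (- (3 * gamma / 2) * H t ^ 2)).
{ intros t ht; pose proof (dp t ht); unfold H; auto_derive; [lra|]; field; lra. }
split; [|exact dH].
assert (d0 : forall t, Derive (fun _ : R => 0) t = 0) by (intros; apply Derive_const).
split.
- simpl; lra.
- intros t ht; apply Rlt_le, Rinv_0_lt_compat, dp, ht.
- intros t _; pose proof (pow2_ge_0 (H t)); lra.
- intros t _; rewrite d0; field.
- intros t ht; rewrite d0; split; [now eexists; apply dH|].
  rewrite (is_derive_unique _ _ _ (dH t ht)); field.
- intros t ht; split; [apply ex_derive_const | split].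
  + apply (ex_derive_ext (fun _ => 0)); [now intros; rewrite d0 | apply ex_derive_const].
  + rewrite (Derive_ext (Derive (fun _ : R => 0)) (fun _ => 0) t d0), d0; ring.
- intros t ht; pose proof (dH t ht) as d.
  assert (dr : is_derive (fun t => 3 * H t ^ 2) t (6 * H t * (- (3 * gamma / 2) * H t ^ 2))).
  { auto_derive; [now eexists; apply d|]; rewrite (Derive_value H _ _ d); ring. }
  split; [now eexists; apply dr|].
  rewrite (Derive_value _ _ _ dr); unfold fluid_pressure; field.
Qed.

(** For the pure fluid dH/dt + H^2 = (1 - 3 gamma/2) H^2, which is positive for gamma < 2/3; the
    scale factor is exp(tau). *)
Lemma acceleration_exists gamma : 0 <= gamma < 2 / 3 ->
  exists ta tb H phi rho a t,
    cosmology gamma ta tb H phi rho /\ scale_factor ta tb H a /\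
    cosmic_times ta tb t /\ accelerated_expansion a t.
Proof.
intros [hg hg'].
destruct (fluid_cosmology gamma hg) as [C dH].
set (H := fun t => / (1 + 3 * gamma / 2 * t)) in *.
change (forall t, cosmic_times 0 1 t -> is_derive H t (- (3 * gamma / 2) * H t ^ 2)) in dH.
destruct (efold_time_exists _ _ _ _ _ _ C) as [tau Et].
assert (S : scale_factor 0 1 H (fun t => exp (tau t))).
{ intros t ht; split; [apply exp_pos|]; pose proof (Et t ht) as d.
  auto_derive; [now eexists; apply d|]; rewrite (Derive_value tau _ _ d); ring. }
assert (ht : cosmic_times 0 1 (/ 2)) by (split; simpl; lra).
assert (hp : 0 < H (/ 2)) by (apply Rinv_0_lt_compat; lra).
exists (Finite 0), (Finite 1), H, (fun _ => 0), (fun t => 3 * H t ^ 2), (fun t => exp (tau t)), (/ 2).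
split; [exact C | split; [exact S | split; [exact ht|]]].
split.
- rewrite (is_derive_unique _ _ _ (proj2 (S _ ht))).
  apply Rmult_lt_0_compat; auto; apply exp_pos.
- rewrite (scale_factor_acceleration 0 1 H); auto.
  + rewrite (is_derive_unique _ _ _ (dH _ ht)).
    apply Rmult_lt_0_compat; [|apply exp_pos].
    replace (- (3 * gamma / 2) * H (/ 2) ^ 2 + H (/ 2) ^ 2) with
      ((1 - 3 * gamma / 2) * H (/ 2) ^ 2) by ring.
    apply Rmult_lt_0_compat; [lra | now apply pow2_gt_0, Rgt_not_eq].
  + intros u hu; eexists; now apply dH.
Qed.

(** * Critical points as cosmological solutions, and the assembled result *)

Lemma critical_points_cosmology gamma ta tb H phi rho t :
  cosmology gamma ta tb H phi rho -> expanding ta tb H -> cosmic_times ta tb t ->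
  (Omega_m H rho t = 0 <-> x_var H phi t ^ 2 = 1) /\
  (Omega_m H rho t = 0 <-> 3 * H t ^ 2 = Derive phi t ^ 2 / 2) /\
  (Omega_m H rho t = 1 <-> 3 * H t ^ 2 = rho t) /\
  (x_var H phi t = 1 -> 0 < Derive phi t) /\
  (x_var H phi t = -1 -> Derive phi t < 0).
Proof.
intros C E ht; pose proof (E t ht) as hp.
pose proof (friedmann _ _ _ _ _ _ C t ht) as fr.
assert (d : 0 < 3 * H t ^ 2) by nra.
assert (dx : 0 < sqrt 6 * H t) by (apply Rmult_lt_0_compat; auto; apply sqrt_lt_R0; lra).
(* Clearing the denominators turns all the claims into polynomial arithmetic. *)
assert (eO : rho t = Omega_m H rho t * (3 * H t ^ 2)) by (unfold Omega_m; field; lra).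
assert (eX : Derive phi t = x_var H phi t * (sqrt 6 * H t)).
{ unfold x_var; field; split; [lra | apply Rgt_not_eq, sqrt_lt_R0; lra]. }
rewrite (Omega_m_x_var gamma ta tb H phi rho t C E ht) in *.
split; [split; lra | split; [split; nra | split; [split; nra | split; intros e; rewrite eX, e; lra]]].
Qed.

Theorem mainTheorem2 (gamma : R) (Hgamma : 0 <= gamma <= 2) :
  (* Reduction to the autonomous equation in tau. *)
  (forall (ta tb : Rbar) (H phi rho tau : R -> R),
     cosmology gamma ta tb H phi rho ->
     expanding ta tb H ->
     efold_time ta tb H tau ->
     (forall t, cosmic_times ta tb t ->
        Omega_m H rho t = 1 - x_var H phi t ^ 2 /\
        Omega_line (Omega_m H rho t) /\ x_line (x_var H phi t)) /\
     exists W X : R -> R,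
       (forall t, cosmic_times ta tb t ->
          W (tau t) = Omega_m H rho t /\ X (tau t) = x_var H phi t) /\
       solves (Omega_field gamma) (range_of_times ta tb tau) W /\
       solves (x_field gamma) (range_of_times ta tb tau) X) /\
  (* Critical points; for gamma = 2 the field vanishes identically. *)
  critical_point (Omega_field gamma) 0 /\
  critical_point (Omega_field gamma) 1 /\
  (gamma < 2 -> forall w, critical_point (Omega_field gamma) w <-> w = 0 \/ w = 1) /\
  (forall (ta tb : Rbar) (H phi rho : R -> R) (t : R),
     cosmology gamma ta tb H phi rho ->
     expanding ta tb H ->
     cosmic_times ta tb t ->
     (Omega_m H rho t = 0 <-> x_var H phi t ^ 2 = 1) /\
     (Omega_m H rho t = 0 <-> 3 * H t ^ 2 = Derive phi t ^ 2 / 2) /\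
     (Omega_m H rho t = 1 <-> 3 * H t ^ 2 = rho t) /\
     (x_var H phi t = 1 -> 0 < Derive phi t) /\
     (x_var H phi t = -1 -> Derive phi t < 0)) /\
  (* The stiff-matter solution Omega_m = 0. *)
  linear_approximation (Omega_field gamma) 0 (fun d => 3 * (2 - gamma) * d) /\
  (forall delta : R -> R,
     solves (fun d => 3 * (2 - gamma) * d) all_times delta <->
     exists delta0 : R, forall tau, delta tau = delta0 * exp (3 * (2 - gamma) * tau)) /\
  (gamma < 2 ->
     ~ stable (Omega_field gamma) Omega_line 0 /\
     (forall p, past_attractor (Omega_field gamma) Omega_line p <-> p = 0) /\
     (forall u, orbit (Omega_field gamma) Omega_line u -> u 0 <> 1 ->
        is_lim u m_infty 0) /\
     (forall p, past_attractor (x_field gamma) x_line p <-> p = 1 \/ p = -1)) /\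
  (* The matter-dominated solution Omega_m = 1. *)
  linear_approximation (Omega_field gamma) 1 (fun d => - (3 * (2 - gamma)) * d) /\
  (forall delta : R -> R,
     solves (fun d => - (3 * (2 - gamma)) * d) all_times delta <->
     exists delta0 : R, forall tau, delta tau = delta0 * exp (- (3 * (2 - gamma)) * tau)) /\
  (gamma < 2 ->
     stable (Omega_field gamma) Omega_line 1 /\
     (forall p, future_attractor (Omega_field gamma) Omega_line p <-> p = 1) /\
     (forall u, orbit (Omega_field gamma) Omega_line u -> u 0 <> 0 ->
        is_lim u p_infty 1)) /\
  (* Initial and final stages of a cosmic history with both components. *)
  (gamma < 2 ->
   forall (ta tb : Rbar) (H phi rho : R -> R) (t0 : R),
     cosmology gamma ta tb H phi rho ->
     expanding ta tb H ->
     inextendible gamma ta tb H phi rho ->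
     cosmic_times ta tb t0 ->
     0 < rho t0 ->
     Derive phi t0 <> 0 ->
     tends_at_end ta tb ta (Omega_m H rho) 0 /\
     (0 < Derive phi t0 -> tends_at_end ta tb ta (x_var H phi) 1) /\
     (Derive phi t0 < 0 -> tends_at_end ta tb ta (x_var H phi) (-1)) /\
     tends_at_end ta tb tb (Omega_m H rho) 1) /\
  (* No accelerated expansion; a fluid with gamma < 2/3 accelerates by itself. *)
  (2 / 3 <= gamma <->
   forall (ta tb : Rbar) (H phi rho a : R -> R),
     cosmology gamma ta tb H phi rho ->
     scale_factor ta tb H a ->
     forall t, cosmic_times ta tb t -> ~ accelerated_expansion a t).
Proof.
split; [|split; [|split; [|split; [|split; [|split; [|split; [|split; [|split; [|split; [|split; [|split]]]]]]]]]]].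
- intros ta tb H phi rho tau C E Et.
  destruct (cosmology_profile _ _ _ _ _ _ _ C E Et) as (A & B & hA & hAB & e).
  assert (eO : forall t, cosmic_times ta tb t -> Omega_profile gamma A B (tau t) = Omega_m H rho t).
  { intros t ht; destruct (e t ht) as (e1 & _ & e3); unfold Omega_m; now rewrite e1, e3. }
  assert (eX : forall t, cosmic_times ta tb t -> x_profile gamma A B (tau t) = x_var H phi t).
  { intros t ht; destruct (e t ht) as (_ & e2 & e3); unfold x_var; now rewrite e2, e3. }
  split.
  + intros t ht.
    pose proof (Omega_m_x_var gamma ta tb H phi rho t C E ht) as r.
    assert (l : Omega_line (Omega_m H rho t)) by (rewrite <- eO; auto; now apply Omega_profile_line).
    split; [exact r | split; [exact l|]].
    apply x_line_of_Omega_line; now rewrite <- r.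
  (* The profiles solve the equations for every tau, in particular on the range of tau. *)
  + exists (Omega_profile gamma A B), (x_profile gamma A B); split; [auto | split].
    * intros s _; now apply Omega_profile_solves.
    * intros s _; now apply x_profile_solves.
- unfold critical_point, Omega_field; ring.
- unfold critical_point, Omega_field; ring.
- intros hg w; unfold critical_point, Omega_field; split.
  + intros h; apply Rmult_integral in h; destruct h as [h|h]; [|right; lra].
    apply Rmult_integral in h; destruct h; [lra | now left].
  + intros [-> | ->]; ring.
- intros; now apply (critical_points_cosmology gamma ta tb).
- apply linear_approximation_of_derive; unfold Omega_field; [ring|].
  auto_derive; auto; ring.
- intros delta; apply solves_linear_iff.
- intros hg; split; [now apply Omega_zero_not_stable | split; [|split]].
  + intros p; now apply Omega_past_attractor_iff.
  + intros u; now apply Omega_past_limit.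
  + intros p; now apply x_past_attractor_iff.
- apply linear_approximation_of_derive; unfold Omega_field; [ring|].
  auto_derive; auto; ring.
- intros delta; apply solves_linear_iff.
- intros hg; split; [now apply Omega_one_stable | split].
  + intros p; now apply Omega_future_attractor_iff.
  + intros u; now apply Omega_limit.
- intros hg ta tb H phi rho t0 C E X h0 r0 p0.
  destruct (Omega_history gamma ta tb H phi rho t0) as [i f]; auto.
  destruct (x_history gamma ta tb H phi rho t0) as [xp xn]; auto.
- split.
  + intros hg ta tb H phi rho a C S t; now apply (no_acceleration gamma ta tb H phi rho).
  + intros h; destruct (Rle_lt_dec (2 / 3) gamma) as [|hg]; auto; exfalso.
    destruct (acceleration_exists gamma) as (ta & tb & H & phi & rho & a & t & C & S & ht & acc);
      [lra|].
    exact (h ta tb H phi rho a C S t ht acc).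
Qed.
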